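(* Let $\gamma\in(0,2)$, $\nu\in(0,1]$, let $K\ge 1$ be an integer, and let $L_\nu>0$. Then there exist a $(\nu,L_\nu)$-Hölder smooth convex function $q_\nu:\mathbb{R}^2\to\mathbb{R}$ with a minimizer $x^\star$, and an initial point $x^0\neq x^\star$, such that the iterates generated by $\gamma$-PolyakGD applied to $q_\nu$ from $x^0$ satisfy $$\min_{1\le k\le K}\ \frac{q_\nu(x^k)-q_\nu(x^\star)}{L_\nu\|x^0-x^\star\|^{\nu+1}}\ \ge\ \frac{2^{\nu-1}\,\gamma^{\frac{\nu+1}{2}}}{\mathrm{e}^{2\gamma}(\nu+1)\big((2(\nu+1)-\gamma)K+\gamma\big)^{\frac{\nu+1}{2}}},$$ where $\mathrm{e}$ denotes Euler's number.
   Context: For a differentiable convex function $f$ with minimal value $f^\star$ and a parameter $\gamma>0$, $\gamma$-PolyakGD is the iteration $x^{k+1}=x^k-\gamma\,\alpha_k\nabla f(x^k)$ with Polyak stepsize $\alpha_k=\dfrac{f(x^k)-f^\star}{\|\nabla f(x^k)\|^2}$, $k=0,1,\dots$ ($\|\cdot\|$ is the Euclidean norm; if $\nabla f(x^k)=0$ the iteration stays at $x^k$). For $\nu\in(0,1]$ and $L_\nu>0$, a differentiable function $f:\mathbb{R}^n\to\mathbb{R}$ is $(\nu,L_\nu)$-Hölder smooth if $\|\nabla f(x)-\nabla f(y)\|\le L_\nu\|x-y\|^\nu$ for all $x,y\in\mathbb{R}^n$. *)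

(* Defs.v *)
From mathcomp Require Import all_boot all_order all_algebra.
From mathcomp Require Import all_classical all_reals all_analysis.
Import Order.TTheory GRing.Theory Num.Theory numFieldNormedType.Exports.

Set Implicit Arguments.
Unset Strict Implicit.
Unset Printing Implicit Defensive.

Local Open Scope classical_set_scope.
Local Open Scope ring_scope.

(* The library norm `|v| on 'rV[R]_n is the sup norm; it induces the same
   topology and the same notion of differentiability. *)
Definition enorm (R : realType) (n : nat) (v : 'rV[R]_n) : R :=
  Num.sqrt (\sum_(i < n) v 0 i ^+ 2).

Definition gradient (R : realType) (n : nat) (f : 'rV[R]_n -> R)
    (x : 'rV[R]_n) : 'rV[R]_n :=
  \row_(i < n) 'D_(delta_mx 0 i) f x.

Definition holder_smooth (R : realType) (n : nat) (nu L : R)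
    (f : 'rV[R]_n -> R) : Prop :=
  (forall x, differentiable f x) /\
  (forall x y,
     enorm (gradient f x - gradient f y) <= L * enorm (x - y) `^ nu).

Definition minimizer (R : realType) (n : nat) (f : 'rV[R]_n -> R)
    (xstar : 'rV[R]_n) : Prop :=
  forall y, f xstar <= f y.

Definition polyak_stepsize (R : realType) (n : nat) (f : 'rV[R]_n -> R)
    (fstar : R) (x : 'rV[R]_n) : R :=
  (f x - fstar) / enorm (gradient f x) ^+ 2.

Definition polyak_step (R : realType) (n : nat) (gamma : R)
    (f : 'rV[R]_n -> R) (fstar : R) (x : 'rV[R]_n) : 'rV[R]_n :=
  if gradient f x == 0 then x
  else x - (gamma * polyak_stepsize f fstar x) *: gradient f x.

Definition polyakGD (R : realType) (n : nat) (gamma : R)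
    (f : 'rV[R]_n -> R) (fstar : R) (x0 : 'rV[R]_n) (k : nat) : 'rV[R]_n :=
  iter k (polyak_step gamma f fstar) x0.

(* The minimum of u 1, ..., u K. The big operator starts from u 1, which
   belongs to the range as soon as 1 <= K. *)
Definition min_upto (R : realType) (K : nat) (u : nat -> R) : R :=
  \big[Num.min/u 1%N]_(1 <= k < K.+1) u k.

(* Main.v *)
Require Import Defs.
From mathcomp Require Import all_boot all_order all_algebra.
From mathcomp Require Import all_classical all_reals all_analysis.
From mathcomp Require Import ring lra.
Import Order.TTheory GRing.Theory Num.Theory numFieldNormedType.Exports.

Local Open Scope classical_set_scope.
Local Open Scope ring_scope.

(** With [p = nu + 1], take [q x = c (a x_0^2 + x_1^2)^(p/2)] with
    [c = L 2^(nu-1) / p].  Its gradient is the weighted image of the map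
    [w |-> |w|^(nu-1) w], which is [nu]-Hoelder with constant [2^(1-nu)].
    The Polyak step only sees [q] through the quadratic form
    [a x_0^2 + x_1^2].  Put [b = (2 p - gamma) / gamma].  Along the direction
    [x_0^2 : x_1^2 = b - a : a (1 - a b)] the step is
    [(u, v) |-> r (u, -v)] with [r = (1 - a) / (1 + a)], so the iterates zigzag
    and shrink only by the factor [r].  It remains to choose [a] of order
    [1 / K], which makes [r^(2 K)] bounded below. *)

(** * Inequalities for real powers, up to the Hölder estimate for [|w|^(r-1) w] *)

Section power_inequalities.
Set Implicit Arguments.
Unset Strict Implicit.
Variable R : realType.
Implicit Types a b c p r s t u v x y : R.

Lemma powR_convex p t x y : 1 <= p -> 0 <= t <= 1 -> 0 <= x -> 0 <= y ->
  (t * x + (1 - t) * y) `^ p <= t * x `^ p + (1 - t) * y `^ p.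
Proof.
move=> p1 /andP[t0 t1] x0 y0.
have := @convex_powR R p p1 (Itv01 t0 t1) x y.
rewrite !inE /= !in_itv /= !andbT => /(_ x0 y0).
by [].
Qed.

(** Convexity of the power [r^-1 >= 1], applied at [x^r] and [y^r]; taking the [r]-th power of both
    sides concludes. *)
Lemma powR_concave r t x y : 0 < r <= 1 -> 0 <= t <= 1 -> 0 <= x -> 0 <= y ->
  t * x `^ r + (1 - t) * y `^ r <= (t * x + (1 - t) * y) `^ r.
Proof.
move=> /andP[r0 r1] t01 x0 y0; have /andP[t0 t1] := t01.
have rK z : 0 <= z -> (z `^ r) `^ r^-1 = z.
  by move=> z0; rewrite -powRrM mulfV ?gt_eqF// powRr1.
have t10 : 0 <= 1 - t by rewrite subr_ge0.
have h : 0 <= t * x `^ r + (1 - t) * y `^ r.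
  by rewrite addr_ge0 ?mulr_ge0 ?powR_ge0.
have := @powR_convex r^-1 t (x `^ r) (y `^ r) _ t01 (powR_ge0 _ _) (powR_ge0 _ _).
rewrite invf_ge1// => /(_ r1); rewrite !rK// => /(ge0_ler_powR (ltW r0)).
rewrite !nnegrE powR_ge0 => /(_ isT); rewrite addr_ge0 ?mulr_ge0// => /(_ isT).
by rewrite -powRrM mulVf ?gt_eqF// powRr1.
Qed.

(** By concavity on the segment from [0] to [x + y], the share [z / (x + y)] of [(x + y)^r] is at
    most [z^r]. The shares of [x] and [y] sum to one. *)
Lemma powRD_le r x y : 0 < r <= 1 -> 0 <= x -> 0 <= y ->
  (x + y) `^ r <= x `^ r + y `^ r.
Proof.
move=> r01 x0 y0; have /andP[r0 _] := r01.
have [xy0|xyn0] := eqVneq (x + y) 0.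
  by rewrite xy0 powR0 ?gt_eqF// addr_ge0 ?powR_ge0.
have xy_gt0 : 0 < x + y by rewrite lt_neqAle eq_sym xyn0 addr_ge0.
have part z : 0 <= z <= x + y -> z / (x + y) * (x + y) `^ r <= z `^ r.
  move=> /andP[z0 zxy].
  have := @powR_concave r (z / (x + y)) (x + y) 0 r01 _ (ltW xy_gt0) (lexx 0).
  rewrite (powR0 (lt0r_neq0 r0)) !mulr0 !addr0 mulfVK//; apply.
  by rewrite divr_ge0 ?ler_pdivrMr ?mul1r// ltW.
have hx := part x; have hy := part y.
have -> : (x + y) `^ r = x / (x + y) * (x + y) `^ r + y / (x + y) * (x + y) `^ r.
  by rewrite -mulrDl -mulrDl divff// mul1r.
by apply: lerD; [apply: hx|apply: hy]; rewrite ?x0 ?y0 ?lerDl ?lerDr.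
Qed.

Lemma ler_dist_powR r x y : 0 < r <= 1 -> 0 <= x -> 0 <= y ->
  `|x `^ r - y `^ r| <= `|x - y| `^ r.
Proof.
move=> r01; have /andP[r0 _] := r01.
wlog yx : x y / y <= x.
  move=> H x0 y0; have [yx|/ltW xy] := leP y x; first exact: H.
  by rewrite distrC (distrC x); apply: H.
move=> x0 y0; rewrite (ger0_norm (_ : 0 <= x - y)) ?subr_ge0//.
rewrite ger0_norm ?subr_ge0; last by rewrite ge0_ler_powR ?nnegrE// ltW.
rewrite lerBlDr -{1}(subrK y x); apply: powRD_le => //.
by rewrite subr_ge0.
Qed.

(** Concavity at the midpoint; the constant is [2 * 2^(-r)]. *)
Lemma powRD_half r x y : 0 < r <= 1 -> 0 <= x -> 0 <= y ->
  x `^ r + y `^ r <= 2 `^ (1 - r) * (x + y) `^ r.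
Proof.
move=> r01 x0 y0; have /andP[r0 _] := r01.
have h0 : (0 <= (2^-1 : R) <= 1) by lra.
have := @powR_concave r 2^-1 x y r01 h0 x0 y0.
have -> : 2^-1 * x + (1 - 2^-1) * y = 2^-1 * (x + y) by field.
rewrite powRM ?invr_ge0 ?addr_ge0// -powR_inv1// -powRrM mulN1r.
rewrite (powRD (r := 1)) ?pnatr_eq0 ?implybT// powRr1// powR_inv1//.
rewrite -mulrA; set Z := _ * (x + y) `^ r; lra.
Qed.

(* Both sides are functions of the cosine [c] of the angle between two vectors
   of lengths [A] and [B]: the left one is affine and the right one concave, so
   it is enough to compare them at [c = 1] and [c = -1]. *)
Lemma holder_cosine r (A B c : R) : 0 < r <= 1 -> 0 <= A -> 0 <= B ->
  -1 <= c <= 1 ->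
  (A `^ r) ^+ 2 + (B `^ r) ^+ 2 - 2 * c * (A `^ r * B `^ r)
  <= (2 `^ (1 - r)) ^+ 2 * (A ^+ 2 + B ^+ 2 - 2 * c * (A * B)) `^ r.
Proof.
move=> r01 A0 B0 /andP[c0 c1].
have sqp (z : R) : (z ^+ 2) `^ r = (`|z| `^ r) ^+ 2.
  by rewrite -real_normK ?num_real// -powR_mulrn ?normr_ge0// powRAC powR_mulrn//.
(* The weight writes [c] as a convex combination of [1] and [-1], whose two endpoints give
   [(A - B)^2] and [(A + B)^2]. *)
have t01 : 0 <= (1 + c) / 2 <= 1 by lra.
have t0 : 0 <= (1 + c) / 2 by lra.
have t1 : 0 <= 1 - (1 + c) / 2 by lra.
have := @powR_concave r ((1 + c) / 2) ((A - B) ^+ 2) ((A + B) ^+ 2) r01 t01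
  (sqr_ge0 _) (sqr_ge0 _).
have -> : (1 + c) / 2 * (A - B) ^+ 2 + (1 - (1 + c) / 2) * (A + B) ^+ 2
   = A ^+ 2 + B ^+ 2 - 2 * c * (A * B) by field.
rewrite !sqp (ger0_norm (addr_ge0 A0 B0)) => h.
have C1 : 1 <= (2 `^ (1 - r)) :> R.
  have /andP[_ r1] := r01.
  by have := @ler_powR R 2 _ 0 (1 - r); rewrite powRr0; apply; rewrite ?ler1n ?subr_ge0.
have hB : (A `^ r - B `^ r) ^+ 2 <= (2 `^ (1 - r)) ^+ 2 * (`|A - B| `^ r) ^+ 2.
  rewrite -exprMn -(real_normK (num_real (A `^ r - B `^ r))) ler_pXn2r ?nnegrE ?mulr_ge0 ?powR_ge0//.
  apply: (le_trans (ler_dist_powR r01 A0 B0)).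
  by rewrite ler_peMl ?powR_ge0.
have hD : (A `^ r + B `^ r) ^+ 2 <= (2 `^ (1 - r)) ^+ 2 * ((A + B) `^ r) ^+ 2.
  rewrite -exprMn ler_pXn2r ?nnegrE ?mulr_ge0 ?addr_ge0 ?powR_ge0//.
  exact: powRD_half.
apply: le_trans (ler_wpM2l (sqr_ge0 _) h).
have := lerD (ler_wpM2l t0 hB) (ler_wpM2l t1 hD); rewrite mulrDr.
by congr (_ <= _); field.
Qed.

Lemma cauchy2 (w1 w2 z1 z2 : R) :
  `|w1 * z1 + w2 * z2|
  <= Num.sqrt (w1 ^+ 2 + w2 ^+ 2) * Num.sqrt (z1 ^+ 2 + z2 ^+ 2).
Proof.
rewrite -sqrtrM ?addr_ge0 ?sqr_ge0// -sqrtr_sqr ler_wsqrtr//.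
have := sqr_ge0 (w1 * z2 - w2 * z1); nra.
Qed.

(** The exponent [e] acts on squared lengths, so [W * w] is the vector of length [|w|^r] in the
    direction of [w]. Both squared distances then depend only on the two lengths and on the cosine
    of the angle, which is the setting of [holder_cosine]. *)
Lemma holder_direction r (w1 w2 z1 z2 : R) : 0 < r <= 1 ->
  let e := (r - 1) / 2 in
  let W := (w1 ^+ 2 + w2 ^+ 2) `^ e in
  let Z := (z1 ^+ 2 + z2 ^+ 2) `^ e in
  (W * w1 - Z * z1) ^+ 2 + (W * w2 - Z * z2) ^+ 2
  <= (2 `^ (1 - r)) ^+ 2 * ((w1 - z1) ^+ 2 + (w2 - z2) ^+ 2) `^ r.
Proof.
move=> r01 /=; have /andP[r0 _] := r01.
have [w0 z0] : 0 <= w1 ^+ 2 + w2 ^+ 2 /\ 0 <= z1 ^+ 2 + z2 ^+ 2.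
  by rewrite !addr_ge0 ?sqr_ge0.
have := cauchy2 w1 w2 z1 z2.
set A := Num.sqrt (w1 ^+ 2 + w2 ^+ 2); set B := Num.sqrt (z1 ^+ 2 + z2 ^+ 2).
have A0 : 0 <= A by exact: sqrtr_ge0.
have B0 : 0 <= B by exact: sqrtr_ge0.
have WA : w1 ^+ 2 + w2 ^+ 2 = A ^+ 2 by rewrite sqr_sqrtr.
have ZB : z1 ^+ 2 + z2 ^+ 2 = B ^+ 2 by rewrite sqr_sqrtr.
rewrite WA ZB => cs.
have pw x : 0 <= x -> (x ^+ 2) `^ ((r - 1) / 2) = x `^ (r - 1).
  by move=> x0; rewrite -powR_mulrn// -powRrM; congr (_ `^ _); field.
rewrite !pw//.
have [c c11 sE] : exists2 c, -1 <= c <= 1 & w1 * z1 + w2 * z2 = c * (A * B).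
  (* If one vector vanishes, so does the inner product, and any cosine serves; [0] is taken. *)
  have [AB0|ABn0] := eqVneq (A * B) 0.
    exists 0; first by lra.
    by apply/eqP; rewrite AB0 mulr0 -normr_le0 -AB0.
  exists ((w1 * z1 + w2 * z2) / (A * B)); last by rewrite mulfVK.
  have ABp : 0 < A * B by rewrite lt_neqAle eq_sym ABn0 mulr_ge0.
  by rewrite -ler_norml normrM normfV (gtr0_norm ABp) ler_pdivrMr// mul1r.
have Ar := mulr_powRB1 A0 r0; have Br := mulr_powRB1 B0 r0.
have := holder_cosine r01 A0 B0 c11; rewrite -Ar -Br.
have -> : A ^+ 2 + B ^+ 2 - 2 * c * (A * B)
    = (w1 - z1) ^+ 2 + (w2 - z2) ^+ 2.
  by rewrite -WA -ZB -mulrA -sE; ring.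
apply: le_trans; rewrite le_eqVlt; apply/orP; left; apply/eqP.
set X := A `^ _; set Y := B `^ _.
have -> : (X * w1 - Y * z1) ^+ 2 + (X * w2 - Y * z2) ^+ 2
  = X ^+ 2 * (w1 ^+ 2 + w2 ^+ 2) + Y ^+ 2 * (z1 ^+ 2 + z2 ^+ 2)
    - 2 * (X * Y) * (w1 * z1 + w2 * z2) by ring.
rewrite WA ZB sE; ring.
Qed.

End power_inequalities.

(** * Choice of the anisotropy [a] and control of the decay *)

Section rate.
Set Implicit Arguments.
Unset Strict Implicit.
Variable R : realType.
Implicit Types a b m : R.

(** The inverse ratio is [1 + 2 a / (1 - a)], at most the exponential of [2 a / (1 - a)]. *)
Lemma expRN_le_ratio_exp a m (n : nat) : 0 <= a < 1 ->
  2 * a / (1 - a) * n%:R <= m -> expR (- m) <= ((1 - a) / (1 + a)) ^+ n.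
Proof.
move=> /andP[a0 a1] hm.
have a1' : 0 < 1 - a by rewrite subr_gt0.
have a2 : 0 < 1 + a by lra.
rewrite -invf_div exprVn expRN lef_pV2 ?posrE ?expR_gt0 ?exprn_gt0 ?divr_gt0//.
apply: le_trans (_ : expR (2 * a / (1 - a) * n%:R) <= _); last by rewrite ler_expR.
rewrite expRM_natr lerXn2r ?nnegrE ?expR_ge0 ?(ltW (divr_gt0 _ _))//.
apply: le_trans (expR_ge1Dx _).
have -> : (1 + a) / (1 - a) = 1 + 2 * a / (1 - a) by field; rewrite gt_eqF.
exact: lexx.
Qed.

(* Any [a <= b] with [a b < 1] gives a zigzag; [a] is [1 / (b K + 1)] if
   [1 <= b], and [min b (1 / (K + 1))] otherwise. *)
Lemma exists_anisotropy b (K : nat) : 0 < b -> (1 <= K)%N ->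
  exists a, [/\ 0 < a < 1, a <= b, a * b < 1
    & expR (- (8 / (1 + b))) <=
      a * (1 + b) / (b * (1 + a)) * ((1 - a) / (1 + a)) ^+ (2 * K)
      * (b * K%:R + 1)].
Proof.
move=> b0 K1.
have k1 : 1 <= K%:R :> R by rewrite ler1n.
have K2 : (2 * K)%:R = 2 * K%:R :> R by rewrite natrM.
set k : R := K%:R in k1 K2 *.
have b1 : 0 < 1 + b by lra.
have k0 : 0 < k by lra.
(* The two requirements separate: [hk] keeps the decay [r^(2 K)] above the exponential, and [hc]
   makes the prefactor times [b K + 1] at least one. *)
suff [a [/andP[a0 a1] ab ab1 hk hc]] : exists a, [/\ 0 < a < 1, a <= b, a * b < 1,
    2 * a / (1 - a) * (2 * k) <= 8 / (1 + b)
    & b * (1 + a) <= a * (1 + b) * (b * k + 1)].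
  exists a; split => //; first by rewrite a0.
  rewrite mulrAC; rewrite -K2 in hk.
  have := expRN_le_ratio_exp (a := a) (n := 2 * K) _ hk.
  rewrite (ltW a0) a1 => /(_ isT) /le_trans; apply.
  rewrite ler_peMl//.
    by rewrite exprn_ge0// divr_ge0// ?subr_ge0 ?addr_ge0// ltW.
  rewrite mulrAC ler_pdivlMr ?mul1r// mulr_gt0//; lra.
have [b_ge1|b_lt1] := leP 1 b.
  have bk : 1 <= b * k by nra.
  have d0 : 0 < b * k + 1 by lra.
  exists (b * k + 1)^-1; split.
  - rewrite invr_gt0 d0 invf_lt1//; lra.
  - apply: le_trans b_ge1; rewrite invf_le1//; lra.
  - rewrite mulrC ltr_pdivrMr// mul1r; nra.
  - have -> : 2 * (b * k + 1)^-1 / (1 - (b * k + 1)^-1) * (2 * k) = 4 / b.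
      by field; apply/and3P; split; rewrite gt_eqF//; lra.
    rewrite ler_pdivrMr// mulrAC ler_pdivlMr//; lra.
  - have -> : (b * k + 1)^-1 * (1 + b) * (b * k + 1) = 1 + b.
      by field; rewrite gt_eqF.
    have -> : b * (1 + (b * k + 1)^-1) = b + b / (b * k + 1) by ring.
    rewrite addrC lerD2r ler_pdivrMr// mul1r; nra.
have [bK|Kb] := leP ((k + 1)^-1) b.
  have d0 : 0 < k + 1 by lra.
  exists (k + 1)^-1; split => //.
  - rewrite invr_gt0 d0 invf_lt1//; lra.
  - rewrite mulrC ltr_pdivrMr// mul1r; lra.
  - have -> : 2 * (k + 1)^-1 / (1 - (k + 1)^-1) * (2 * k) = 4.
      by field; apply/andP; split; rewrite gt_eqF//; lra.
    rewrite ler_pdivlMr//; lra.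
  - have -> : b * (1 + (k + 1)^-1) = b * (k + 2) / (k + 1).
      by field; rewrite gt_eqF.
    rewrite ler_pdivrMr//.
    have -> : (k + 1)^-1 * (1 + b) * (b * k + 1) * (k + 1) = (1 + b) * (b * k + 1).
      by field; rewrite gt_eqF.
    nra.
(* For such small [b] the choice is [a = b], so the zigzag direction is the second axis. The
   exponent is bounded through [b k < 1 - b] and [1 + b < 2]. *)
have hb : b * (k + 1) < 1 by rewrite -ltr_pdivlMr ?div1r//; lra.
exists b; split => //.
- by rewrite b0.
- nra.
- have d0 : 0 < 1 - b by lra.
  rewrite mulrAC ler_pdivrMr// [leRHS]mulrAC ler_pdivlMr//; nra.
- by rewrite ler_peMr ?mulr_ge0 ?lerDr ?mulr_ge0// ltW.
Qed.

End rate.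

(** * The weighted norm and its powers *)

Section weighted_norm_power.
Set Implicit Arguments.
Unset Strict Implicit.
Variable R : realType.
Implicit Types (gamma nu a b c p : R) (x y v : 'rV[R]_2).

(** The weight is a parameter because three values occur: [a] in the objective, [1] for the
    Euclidean norm, and [a ^+ 2] for the length of the gradient. *)
Definition sqwnorm a x : R := a * x 0 0 ^+ 2 + x 0 1 ^+ 2.

Definition wnorm_pow c a p x : R := c * sqwnorm a x `^ (p / 2).

Lemma rV2P x y : x 0 0 = y 0 0 -> x 0 1 = y 0 1 -> x = y.
Proof.
move=> h0 h1; apply/rowP => -[[|[|//]] i2].
  by rewrite (_ : Ordinal i2 = 0)//; exact: val_inj.
by rewrite (_ : Ordinal i2 = 1)//; exact: val_inj.
Qed.

Lemma sqwnorm_ge0 a x : 0 <= a -> 0 <= sqwnorm a x.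
Proof. by move=> a0; rewrite /sqwnorm addr_ge0 ?sqr_ge0// mulr_ge0 ?sqr_ge0. Qed.

Lemma sqwnorm_eq0 a x : 0 < a -> sqwnorm a x = 0 -> x = 0.
Proof.
move=> a0 /eqP; rewrite /sqwnorm paddr_eq0 ?sqr_ge0 ?(mulr_ge0 (ltW a0)) ?sqr_ge0//.
rewrite mulf_eq0 gt_eqF//= !sqrf_eq0 => /andP[/eqP x0 /eqP x1].
by apply: rV2P; rewrite mxE.
Qed.

Lemma wnorm_pow0 c a p : 0 < p -> wnorm_pow c a p 0 = 0.
Proof.
move=> p0; rewrite /wnorm_pow /sqwnorm !mxE expr0n /= mulr0 addr0 powR0 ?mulr0//.
by rewrite gt_eqF ?divr_gt0.
Qed.

Lemma enorm2E x : enorm x = Num.sqrt (sqwnorm 1 x).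
Proof.
rewrite /enorm /sqwnorm !big_ord_recl big_ord0 addr0 mul1r.
by rewrite (_ : lift _ _ = 1)//; exact: val_inj.
Qed.

(** * Differentiability and the gradient *)

Lemma is_diff_coord x (i : 'I_2) :
  is_diff x (fun y : 'rV[R]_2 => y 0 i : R) (fun v => v 0 i).
Proof.
have @f : {linear 'rV[R]_2 -> R}.
  by exists (fun N : 'rV[R]_2 => N 0 i); do 2![eexists]; do ?[constructor];
     rewrite ?mxE// => ? *; rewrite ?mxE//; move=> ?; rewrite !mxE.
rewrite (_ : (fun _ => _) = f) //.
have cf : continuous f by exact: coord_continuous.
by apply: DiffDef; [exact: linear_differentiable|rewrite diff_lin].
Qed.

Lemma is_diff_sqwnorm a x :
  is_diff x (sqwnorm a) (fun v => 2 * (a * x 0 0 * v 0 0 + x 0 1 * v 0 1)).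
Proof.
have d0 := is_diff_coord x 0; have d1 := is_diff_coord x 1.
(* The index of [is_diffX] is the exponent minus one, so [1] stands for squares. *)
have := is_diffD (is_diffZ a (is_diffX 1 d0)) (is_diffX 1 d1).
have -> : (a *: (fun y : 'rV[R]_2 => y 0 0 : R) ^+ 2
           + (fun y : 'rV[R]_2 => y 0 1 : R) ^+ 2)%R = sqwnorm a.
  by apply/funext => y.
move=> /is_diff_eq; apply; apply/funext => v /=.
transitivity (a * (2 * x 0 0 * v 0 0) + 2 * x 0 1 * v 0 1); first by [].
ring.
Qed.

Lemma is_diff_powR p (t : R) : 0 < t ->
  is_diff t (fun s : R => s `^ p) (fun h => h * (p * t `^ (p - 1))).
Proof.
move=> t0; have d := is_derive1_powR p t0.
have dt : derivable (fun s : R => s `^ p) t 1 by exact: ex_derive.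
apply: DiffDef; first exact/derivable1_diffP.
by rewrite deriv1E// derive1E derive_val.
Qed.

Lemma sqwnorm_le_norm a x : 0 <= a <= 1 -> sqwnorm a x <= 2 * `|x| ^+ 2.
Proof.
move=> /andP[a0 a1].
have xi (i : 'I_2) : x 0 i ^+ 2 <= `|x| ^+ 2.
  rewrite -real_normK ?num_real// lerXn2r ?nnegrE//.
  by rewrite [leRHS]/Num.norm /= mx_normrE; apply/bigmax_geP; right; exists (0, i).
have := xi 0; have := xi 1; have := sqr_ge0 (x 0 0); rewrite /sqwnorm; nra.
Qed.

Lemma powR_half_sqr p (t : R) : 0 <= t -> (t ^+ 2) `^ (p / 2) = t `^ p.
Proof.
move=> t0; rewrite -powR_mulrn// -powRrM; congr (_ `^ _).
by rewrite mulrCA divff ?mulr1.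
Qed.

(** Near the origin the function is at most [C |h|^p] with [p > 1], hence [o(|h|)], and its
    differential is zero. *)
Lemma is_diff_wnorm_pow0 c a p : 0 < c -> 0 <= a <= 1 -> 1 < p ->
  is_diff (0 : 'rV[R]_2) (wnorm_pow c a p) 0.
Proof.
move=> c0 a01 p1; have /andP[a0 _] := a01.
have q0 : wnorm_pow c a p 0 = 0 by apply: wnorm_pow0; lra.
have [d0c _] := @dcst R 'rV[R]_2 R 0 0.
have o : wnorm_pow c a p \o shift 0
    = cst (wnorm_pow c a p 0) + (\0 : 'rV[R]_2 -> R) +o_ (0 : 'rV[R]_2) id.
  apply/eqaddoP => e e0; rewrite q0.
  pose C := c * 2 `^ (p / 2).
  have C0 : 0 < C by rewrite mulr_gt0 ?powR_gt0.
  have p10 : 0 < p - 1 by lra.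
  near=> h.
  have -> : (wnorm_pow c a p \o shift 0 - (cst 0 + \0)) h = wnorm_pow c a p h.
    transitivity (wnorm_pow c a p (h + 0) - (0 + 0)); first by [].
    by rewrite !addr0 subr0.
  rewrite ger0_norm; last by rewrite mulr_ge0 ?powR_ge0 ?ltW.
  have hN : wnorm_pow c a p h <= C * `|h| `^ p.
    rewrite /C -mulrA ler_pM2l// -(powR_half_sqr _ (normr_ge0 h)) -powRM//.
      rewrite ge0_ler_powR ?nnegrE ?mulr_ge0 ?sqwnorm_ge0 ?sqwnorm_le_norm//.
      by lra.
  apply: (le_trans hN); rewrite -(@mulr_powRB1 _ `|h| p)//; last by lra.
  rewrite mulrCA mulrC ler_wpM2r// mulrC -ler_pdivlMr//.
  (* This gives the radius of the neighbourhood: [|h|^(p-1) <= e / C] as soon as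
     [|h| < (e / C)^(1/(p-1))]. *)
  have -> : e / C = ((e / C) `^ (p - 1)^-1) `^ (p - 1).
    by rewrite -powRrM mulVf ?gt_eqF// powRr1// divr_ge0 ?ltW.
  rewrite ge0_ler_powR ?nnegrE ?powR_ge0 ?(ltW p10)// ltW//.
  near: h; apply: (@nbhs0_lt _ (matrix R 1 2)).
  by rewrite powR_gt0 ?divr_gt0.
have dE : 'd (wnorm_pow c a p) (0 : 'rV[R]_2) = (\0 : 'rV[R]_2 -> R) :> (_ -> _).
  exact: diff_unique.
apply: DiffDef => //; apply/diff_locallyP; rewrite dE; split => //.
Unshelve. all: by end_near. Qed.

(* At [x = 0] the negative power of [0] is multiplied by [0]. *)
Lemma is_diff_wnorm_pow c a p x : 0 < c -> 0 < a <= 1 -> 1 < p ->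
  is_diff x (wnorm_pow c a p) (fun v =>
    c * p * sqwnorm a x `^ (p / 2 - 1) * (a * x 0 0 * v 0 0 + x 0 1 * v 0 1)).
Proof.
move=> c0 /andP[a0 a1] p1.
have [N0|Nn0] := eqVneq (sqwnorm a x) 0.
  rewrite (sqwnorm_eq0 a0 N0); apply: is_diff_eq.
    by apply: is_diff_wnorm_pow0 => //; rewrite ltW.
  apply/funext => v; rewrite !mxE; transitivity (0 : R); first by [].
  ring.
have N0 : 0 < sqwnorm a x by rewrite lt_neqAle eq_sym Nn0 sqwnorm_ge0// ltW.
have := is_diffZ c (is_diff_comp (is_diff_sqwnorm a x) (is_diff_powR (p / 2) N0)).
move=> /is_diff_eq; apply; apply/funext => v.
transitivity (c * (2 * (a * x 0 0 * v 0 0 + x 0 1 * v 0 1)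
  * (p / 2 * sqwnorm a x `^ (p / 2 - 1)))); first by [].
by field.
Qed.

Lemma gradient_wnorm_pow c a p x : 0 < c -> 0 < a <= 1 -> 1 < p ->
  let g := gradient (wnorm_pow c a p) x in
  let k := c * p * sqwnorm a x `^ (p / 2 - 1) in
  g 0 0 = k * (a * x 0 0) /\ g 0 1 = k * x 0 1.
Proof.
move=> c0 a01 p1 /=; have d := is_diff_wnorm_pow x c0 a01 p1.
by split; rewrite mxE deriveE// diff_val !mxE /=; ring.
Qed.

(** * Hölder smoothness and convexity *)

(** With [S = diag(sqrt a, 1)] and [w = S x], the gradient is [c p S (|w|^(nu-1) w)]. Since
    [a <= 1], neither occurrence of [S] increases distances, so the constant of [holder_direction]
    survives. *)
Lemma holder_smooth_wnorm_pow nu c a : 0 < nu <= 1 -> 0 < c -> 0 < a <= 1 ->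
  holder_smooth nu (c * (nu + 1) * 2 `^ (1 - nu)) (wnorm_pow c a (nu + 1)).
Proof.
move=> nu01 c0 a01; have /andP[nu0 nu1] := nu01; have /andP[a0 a1] := a01.
have p1 : 1 < nu + 1 by lra.
split=> [x|x y]; first by have := is_diff_wnorm_pow x c0 a01 p1; case.
have [gx0 gx1] := gradient_wnorm_pow x c0 a01 p1.
have [gy0 gy1] := gradient_wnorm_pow y c0 a01 p1.
have D0 (z : 'rV[R]_2) : 0 <= sqwnorm 1 z by exact: sqwnorm_ge0.
have pw : (nu + 1) / 2 - 1 = (nu - 1) / 2 by field.
have Y0 : 0 <= c * (nu + 1) * 2 `^ (1 - nu) * enorm (x - y) `^ nu.
  by rewrite !mulr_ge0 ?powR_ge0//; lra.
rewrite [leLHS]enorm2E -(ger0_norm Y0) -sqrtr_sqr ler_wsqrtr//.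
have -> : (c * (nu + 1) * 2 `^ (1 - nu) * enorm (x - y) `^ nu) ^+ 2
   = (c * (nu + 1)) ^+ 2 * ((2 `^ (1 - nu)) ^+ 2 * sqwnorm 1 (x - y) `^ nu).
  have -> : sqwnorm 1 (x - y) `^ nu = (enorm (x - y) `^ nu) ^+ 2.
    rewrite enorm2E -[in LHS](sqr_sqrtr (D0 (x - y))).
    by rewrite -[in LHS]powR_mulrn ?sqrtr_ge0// powRAC powR_mulrn ?powR_ge0.
  by rewrite !exprMn; ring.
have sa : Num.sqrt a ^+ 2 = a by rewrite sqr_sqrtr// ltW.
have := holder_direction (Num.sqrt a * x 0 0) (x 0 1) (Num.sqrt a * y 0 0) (y 0 1)
  nu01.
rewrite /= -/(sqwnorm _ _) !exprMn sa -!/(sqwnorm a _).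
set W := sqwnorm a x `^ _; set Z := sqwnorm a y `^ _ => H.
have -> : sqwnorm 1 (gradient (wnorm_pow c a (nu + 1)) x
    - gradient (wnorm_pow c a (nu + 1)) y)
  = (c * (nu + 1)) ^+ 2 * (a * (W * (Num.sqrt a * x 0 0) - Z * (Num.sqrt a * y 0 0)) ^+ 2
     + (W * x 0 1 - Z * y 0 1) ^+ 2).
  have e2 : a * (W * (Num.sqrt a * x 0 0) - Z * (Num.sqrt a * y 0 0)) ^+ 2
     = a ^+ 2 * (W * x 0 0 - Z * y 0 0) ^+ 2.
    by rewrite -[in RHS]sa -[in X in X * _ = _]sa; ring.
  rewrite e2 /sqwnorm.
  have gB (i : 'I_2) : (gradient (wnorm_pow c a (nu + 1)) x
    - gradient (wnorm_pow c a (nu + 1)) y) 0 i =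
    gradient (wnorm_pow c a (nu + 1)) x 0 i
    - gradient (wnorm_pow c a (nu + 1)) y 0 i by rewrite !mxE.
  by rewrite !gB gx0 gx1 gy0 gy1 pw -/W -/Z; ring.
rewrite -[c ^+ 2 * _]exprMn ler_wpM2l ?sqr_ge0//; apply: (le_trans _ (le_trans H _)).
  by rewrite lerD2r ler_piMl ?sqr_ge0.
rewrite ler_wpM2l ?sqr_ge0// ge0_ler_powR ?nnegrE ?(ltW nu0)//.
  by rewrite addr_ge0 ?sqr_ge0.
have -> : (Num.sqrt a * x 0 0 - Num.sqrt a * y 0 0) ^+ 2 = a * (x 0 0 - y 0 0) ^+ 2.
  by rewrite -[in RHS]sa; ring.
by rewrite /sqwnorm !mxE lerD2r mul1r ler_piMl ?sqr_ge0.
Qed.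

(** After squaring, the two sides differ only in the cross term, which Cauchy-Schwarz in the
    coordinates [(sqrt a x_0, x_1)] controls. *)
Lemma sqrt_sqwnorm_convex a (t : R) x y : 0 <= a -> 0 <= t <= 1 ->
  Num.sqrt (sqwnorm a (t *: x + (1 - t) *: y))
  <= t * Num.sqrt (sqwnorm a x) + (1 - t) * Num.sqrt (sqwnorm a y).
Proof.
move=> a0 /andP[t0 t1]; have t10 : 0 <= 1 - t by lra.
have sa : Num.sqrt a ^+ 2 = a by rewrite sqr_sqrtr.
have := cauchy2 (Num.sqrt a * x 0 0) (x 0 1) (Num.sqrt a * y 0 0) (y 0 1).
rewrite !exprMn sa -!/(sqwnorm a _) => /(le_trans (ler_norm _)).
have -> : Num.sqrt a * x 0 0 * (Num.sqrt a * y 0 0) + x 0 1 * y 0 1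
  = a * (x 0 0 * y 0 0) + x 0 1 * y 0 1 by rewrite -[in RHS]sa; ring.
have := sqr_sqrtr (sqwnorm_ge0 x a0); have := sqr_sqrtr (sqwnorm_ge0 y a0).
set A := Num.sqrt (sqwnorm a x); set B := Num.sqrt (sqwnorm a y) => hB hA cs.
have A0 : 0 <= A by exact: sqrtr_ge0.
have B0 : 0 <= B by exact: sqrtr_ge0.
have AB : 0 <= t * A + (1 - t) * B by rewrite addr_ge0 ?mulr_ge0.
rewrite -(ger0_norm AB) -sqrtr_sqr ler_wsqrtr//.
have -> : sqwnorm a (t *: x + (1 - t) *: y) = t ^+ 2 * sqwnorm a x
    + (1 - t) ^+ 2 * sqwnorm a y
    + 2 * (t * (1 - t)) * (a * (x 0 0 * y 0 0) + x 0 1 * y 0 1).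
  by rewrite /sqwnorm !mxE; ring.
rewrite -hA -hB.
have -> : (t * A + (1 - t) * B) ^+ 2 = t ^+ 2 * A ^+ 2 + (1 - t) ^+ 2 * B ^+ 2
    + 2 * (t * (1 - t)) * (A * B) by ring.
by rewrite lerD2l ler_wpM2l ?mulr_ge0.
Qed.

(** The function is the weighted norm, which is convex, followed by [z |-> c z^p], convex and
    nondecreasing on nonnegative reals. *)
Lemma convex_wnorm_pow c a p : 0 <= c -> 0 <= a -> 1 <= p ->
  convex_function setT (wnorm_pow c a p).
Proof.
move=> c0 a0 p1 t x y _ _.
have t01 : 0 <= t%:num <= 1 by rewrite ge0 le1.
change (wnorm_pow c a p (t%:num *: (x : 'rV[R]_2) + (1 - t%:num) *: (y : 'rV[R]_2))
  <= t%:num * wnorm_pow c a p x + (1 - t%:num) * wnorm_pow c a p y).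
have qE (z : 'rV[R]_2) : wnorm_pow c a p z = c * Num.sqrt (sqwnorm a z) `^ p.
  rewrite /wnorm_pow -[in LHS](sqr_sqrtr (sqwnorm_ge0 z a0)).
  by rewrite powR_half_sqr ?sqrtr_ge0.
rewrite !qE [leRHS](_ : _ = c * (t%:num * Num.sqrt (sqwnorm a x) `^ p
  + (1 - t%:num) * Num.sqrt (sqwnorm a y) `^ p)); last by ring.
rewrite ler_wpM2l//.
apply: le_trans (powR_convex p1 t01 (sqrtr_ge0 _) (sqrtr_ge0 _)).
rewrite ge0_ler_powR ?nnegrE ?sqrtr_ge0 ?sqrt_sqwnorm_convex//; lra.
Qed.

(** * Dynamics of the Polyak iteration *)

(** With [k] the scalar factor of the gradient, the value is [(k / p) * sqwnorm a x] and the squared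
    gradient length is [k^2 * sqwnorm (a ^+ 2) x]. Hence [k] cancels from the step. *)
Lemma polyak_step_wnorm_pow gamma c a p x : 0 < c -> 0 < a <= 1 -> 1 < p ->
  x <> 0 ->
  let s := gamma / p * (sqwnorm a x / sqwnorm (a ^+ 2) x) in
  let y := polyak_step gamma (wnorm_pow c a p) 0 x in
  y 0 0 = (1 - s * a) * x 0 0 /\ y 0 1 = (1 - s) * x 0 1.
Proof.
move=> c0 a01 p1 xn0; have /andP[a0 a1] := a01.
have Npos b : 0 < b -> 0 < sqwnorm b x.
  move=> b0; rewrite lt_neqAle sqwnorm_ge0 ?(ltW b0)// andbT eq_sym.
  by apply/eqP => /(sqwnorm_eq0 b0).
have [g0 g1] := gradient_wnorm_pow x c0 a01 p1.
rewrite /polyak_step /polyak_stepsize; set g := gradient _ x in g0 g1 *.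
have G0 : 0 < sqwnorm (a ^+ 2) x by rewrite Npos ?exprn_gt0.
have N0 : 0 < sqwnorm a x by rewrite Npos.
set k := c * p * sqwnorm a x `^ (p / 2 - 1) in g0 g1.
have k0 : 0 < k by rewrite !mulr_gt0 ?powR_gt0//; lra.
have gE : enorm g ^+ 2 = k ^+ 2 * sqwnorm (a ^+ 2) x.
  by rewrite enorm2E sqr_sqrtr ?sqwnorm_ge0// /sqwnorm g0 g1; ring.
have -> : (g == 0) = false.
  apply/eqP => gz; have /eqP := gE.
  rewrite gz enorm2E sqr_sqrtr ?sqwnorm_ge0//.
  rewrite {1}/sqwnorm !mxE expr0n mulr0 addr0 eq_sym.
  by rewrite gt_eqF// mulr_gt0// exprn_gt0.
have qE : wnorm_pow c a p x = k / p * sqwnorm a x.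
  rewrite /wnorm_pow /k -(@mulr_powRB1 _ (sqwnorm a x) (p / 2)) ?(ltW N0)//.
    by field; rewrite gt_eqF//; lra.
  by rewrite divr_gt0//; lra.
clearbody g; rewrite gE subr0 qE; have p0 : 0 < p by lra.
by split; rewrite !mxE ?g0 ?g1; field; rewrite !gt_eqF.
Qed.

(** On the given direction the two quadratic forms have ratio [(1 + b) / (1 + a)], so
    [s = 2 / (1 + a)]. The step factors [1 - s a] and [1 - s] are then [r] and [-r], and the squared
    coordinates keep their ratio. *)
Lemma polyakGD_wnorm_pow gamma c a b p x0 k : 0 < c -> 0 < a < 1 -> 1 < p ->
  a * b < 1 -> gamma * (1 + b) = 2 * p ->
  x0 0 0 ^+ 2 = b - a -> x0 0 1 ^+ 2 = a * (1 - a * b) ->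
  let r := (1 - a) / (1 + a) in
  let y := polyakGD gamma (wnorm_pow c a p) 0 x0 k in
  y 0 0 = r ^+ k * x0 0 0 /\ y 0 1 = (- r) ^+ k * x0 0 1.
Proof.
move=> c0 /andP[a0 a1] p1 ab gb u2 v2 r.
have a01 : 0 < a <= 1 by rewrite a0 ltW.
have r0 : r != 0 by rewrite gt_eqF// divr_gt0//; lra.
have rE : r = (1 - a) / (1 + a) by [].
clearbody r.
elim: k => [|k [IH0 IH1]]; first by rewrite !mul1r.
rewrite /polyakGD iterS -/(polyakGD _ _ _ _ _).
set y := polyakGD _ _ _ _ _ in IH0 IH1 *.
(* The second coordinate stays nonzero, because [r] and [a (1 - a b)] are nonzero. *)
have yn0 : y <> 0.
  move=> yz; have /eqP := IH1; rewrite yz mxE eq_sym mulf_eq0 expf_eq0 oppr_eq0.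
  rewrite (negPf r0) andbF /= -(sqrf_eq0 (x0 0 1)) v2 mulf_eq0 gt_eqF//=.
  by rewrite subr_eq0 gt_eqF.
have [-> ->] := polyak_step_wnorm_pow gamma c0 a01 p1 yn0.
rewrite IH0 IH1.
have rk : r ^+ k != 0 by rewrite expf_neq0.
have sE (e : R) : sqwnorm e y = (r ^+ k) ^+ 2 * (e * (b - a) + a * (1 - a * b)).
  have rr : ((- r) ^+ k) ^+ 2 = (r ^+ k) ^+ 2 by rewrite exprAC sqrrN exprAC.
  by rewrite /sqwnorm IH0 IH1 !exprMn u2 v2 rr; ring.
have p0 : 0 < p by lra.
have s2 : gamma / p * (sqwnorm a y / sqwnorm (a ^+ 2) y) = 2 / (1 + a).
  rewrite !sE.
  have b1 : 1 + b != 0 by apply/eqP => bz; move: gb; rewrite bz mulr0; lra.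
  have -> : gamma = 2 * p / (1 + b) by rewrite -gb mulfK.
  have -> : a ^+ 2 * (b - a) + a * (1 - a * b) = a * ((1 - a) * (1 + a)) by ring.
  have -> : a * (b - a) + a * (1 - a * b) = a * ((1 - a) * (1 + b)) by ring.
  by field; rewrite b1 rk !gt_eqF//; lra.
rewrite s2 !exprS; split.
  by rewrite mulrA; congr (_ * _ * _); rewrite rE; field; rewrite gt_eqF//; lra.
by rewrite mulrA; congr (_ * _ * _); rewrite rE; field; rewrite gt_eqF//; lra.
Qed.

End weighted_norm_power.

(** * Assembly of the lower bound *)

Theorem theorem3p3 (R : realType) (gamma nu L : R) (K : nat)
    (hgamma : 0 < gamma < 2) (hnu : 0 < nu <= 1)
    (hK : (1 <= K)%N) (hL : 0 < L) :
  exists (q : 'rV[R]_2 -> R) (xstar x0 : 'rV[R]_2),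
    [/\ holder_smooth nu L q, convex_function setT q,
        minimizer q xstar, x0 <> xstar
      & 2 `^ (nu - 1) * gamma `^ ((nu + 1) / 2)
          / (expR (2 * gamma) * (nu + 1)
             * ((2 * (nu + 1) - gamma) * K%:R + gamma) `^ ((nu + 1) / 2))
        <= min_upto K (fun k : nat =>
             (q (polyakGD gamma q (q xstar) x0 k) - q xstar)
             / (L * enorm (x0 - xstar) `^ (nu + 1)))].
Proof.
have /andP[g0 g2] := hgamma; have /andP[nu0 nu1] := hnu.
set p := nu + 1; have p1 : 1 < p by rewrite /p; lra.
have p0 : 0 < p by lra.
(* This [b] gives [gamma (1 + b) = 2 p], and [b K + 1] is the bracket of the bound divided by
   [gamma]. *)
pose b := (2 * p - gamma) / gamma.
have b0 : 0 < b by rewrite divr_gt0//; lra.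
have gb : gamma * (1 + b) = 2 * p by rewrite /b; field; rewrite gt_eqF.
have [a [a01 ab ab1 rate]] := exists_anisotropy b0 hK.
have /andP[a0 a1] := a01; have a01' : 0 < a <= 1 by rewrite a0 ltW.
(* Chosen so that the Hölder constant [c p 2^(1-nu)] equals [L]. *)
pose c := L * 2 `^ (nu - 1) / p.
have c0 : 0 < c by rewrite divr_gt0 ?mulr_gt0 ?powR_gt0.
pose x0 : 'rV[R]_2 :=
  \row_i (if i == 0 then Num.sqrt (b - a) else Num.sqrt (a * (1 - a * b))).
have u2 : x0 0 0 ^+ 2 = b - a by rewrite mxE eqxx sqr_sqrtr// subr_ge0.
have v2 : x0 0 1 ^+ 2 = a * (1 - a * b).
  by rewrite mxE /= sqr_sqrtr// mulr_ge0 ?subr_ge0 ?ltW.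
have q0 : wnorm_pow c a p 0 = 0 by exact: wnorm_pow0.
exists (wnorm_pow c a p), 0, x0; split.
- have -> : L = c * (nu + 1) * 2 `^ (1 - nu).
    by rewrite /c -/p -(opprB 1 nu) powRN; field; rewrite !gt_eqF ?powR_gt0.
  exact: holder_smooth_wnorm_pow.
- by apply: convex_wnorm_pow; rewrite ltW.
- by move=> y; rewrite q0 mulr_ge0 ?powR_ge0 ?ltW.
- move=> x0z; move: v2; rewrite x0z mxE expr0n /= => /eqP.
  by rewrite eq_sym gt_eqF// mulr_gt0 ?subr_gt0.
rewrite q0 subr0.
set lb := (X in X <= _).
suff H k : (k <= K)%N -> lb <= (wnorm_pow c a p
     (polyakGD gamma (wnorm_pow c a p) 0 x0 k) - 0) / (L * enorm x0 `^ p).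
  (* The initial value of the minimum is the term at [k = 1], covered by [H] because [1 <= K]. *)
  rewrite /min_upto big_nat_cond; apply: le_bigmin; first exact: H.
  by move=> k /andP[/andP[_ kK] _]; exact: H.
move=> kK; rewrite subr0.
have [y0 y1] := polyakGD_wnorm_pow k c0 a01 p1 ab1 gb u2 v2.
set r := (1 - a) / (1 + a) in y0 y1 rate.
have a2 : 0 < 1 + a by lra.
have r0 : 0 <= r by rewrite divr_ge0//; lra.
have r1 : r <= 1 by rewrite ler_pdivrMr//; lra.
clearbody r.
have b1 : 0 < 1 + b by lra.
have D0 : 0 < b * (1 - a ^+ 2) by rewrite mulr_gt0//; nra.
have eE : enorm x0 `^ p = (b * (1 - a ^+ 2)) `^ (p / 2).
  rewrite enorm2E /sqwnorm u2 v2.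
  have -> : 1 * (b - a) + a * (1 - a * b) = b * (1 - a ^+ 2) by ring.
  rewrite -[in RHS](sqr_sqrtr (ltW D0)) powR_half_sqr// sqrtr_ge0//.
(* [M] is the weighted squared norm of the [k]-th iterate divided by the squared Euclidean norm of
   [x0]. *)
pose M := a * (1 + b) / (b * (1 + a)) * r ^+ (2 * k).
have M0 : 0 <= M by rewrite mulr_ge0 ?exprn_ge0// divr_ge0// mulr_ge0 ?ltW.
have -> : wnorm_pow c a p (polyakGD gamma (wnorm_pow c a p) 0 x0 k)
    / (L * enorm x0 `^ p) = 2 `^ (nu - 1) / p * M `^ (p / 2).
  have NE : sqwnorm a (polyakGD gamma (wnorm_pow c a p) 0 x0 k)
      = M * (b * (1 - a ^+ 2)).
    have rr : ((- r) ^+ k) ^+ 2 = r ^+ (2 * k) by rewrite exprAC sqrrN exprM.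
    have rr' : (r ^+ k) ^+ 2 = r ^+ (2 * k) by rewrite exprAC exprM.
    by rewrite /sqwnorm y0 y1 !exprMn u2 v2 rr rr' /M; field; rewrite !gt_eqF.
  rewrite /wnorm_pow NE eE powRM// ?(ltW D0)// /c; field.
  by rewrite !gt_eqF ?powR_gt0.
have bk0 : 0 < b * K%:R + 1 by rewrite ltr_wpDl// mulr_ge0// ltW.
pose D := (2 * p - gamma) * K%:R + gamma.
have D0' : 0 < D by rewrite ltr_wpDl// mulr_ge0//; lra.
have -> : lb = 2 `^ (nu - 1) / p
    * (expR (- (8 / (1 + b))) / (b * K%:R + 1)) `^ (p / 2).
  have -> : b * K%:R + 1 = D / gamma by rewrite /b /D; field; rewrite gt_eqF.
  (* The constant [8 / (1 + b)] of the rate becomes [4 p / (1 + b) = 2 gamma], the exponent of the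
     theorem. *)
  have eb : - (8 / (1 + b)) * (p / 2) = - (2 * gamma).
    have -> : gamma = 2 * p / (1 + b) by rewrite -gb mulfK// gt_eqF.
    by field; rewrite gt_eqF.
  rewrite invf_div powRM ?expR_ge0 ?divr_ge0 ?(ltW g0) ?(ltW D0')// -expRM eb.
  rewrite powRM ?invr_ge0 ?(ltW g0) ?(ltW D0')// -(powR_inv1 (ltW D0')).
  rewrite -powRrM mulN1r powRN expRN /lb -/D.
  by field; rewrite !gt_eqF ?expR_gt0 ?powR_gt0.
rewrite ler_wpM2l//; first by rewrite divr_ge0 ?powR_ge0// ltW.
rewrite ge0_ler_powR ?nnegrE ?divr_ge0 ?expR_ge0 ?(ltW bk0) ?(ltW p0)//.
(* The rate is stated at the last index [K], which is the worst one: [r^(2 K) <= r^(2 k)] since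
   [0 <= r <= 1]. *)
rewrite ler_pdivrMr//; apply: (le_trans rate); rewrite ler_wpM2r ?(ltW bk0)//.
rewrite ler_wpM2l//; first by rewrite divr_ge0// mulr_ge0 ?ltW.
by rewrite ler_wiXn2l// leq_mul2l.
Qed.
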